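(* For every positive integer $n$, the following identity holds (as formal power series in $z_0$ whose coefficients are Laurent polynomials in $s, z_{\pm1},\ldots,z_{\pm n}$): \[ \sum_{ k \ge 0 } \prod_{ j=1 }^n \left( [k+1]_{ z_j } + s \, z_{-j}^{ -1 } [k]_{ z_{-j}^{ -1 } } \right) z_0^k \ = \ \sum_{ (\pi,\epsilon)\in B_n } s^{\mathrm{neg}(\epsilon)} \frac{\displaystyle \prod_{ j \in \mathrm{NatDes}(\pi, \epsilon) } z_0z_{ \epsilon_{j+1} \pi(j+1) }^{ \epsilon_{j+1} } z_{ \epsilon_{j+2} \pi(j+2) }^{ \epsilon_{j+2} } \cdots z_{\epsilon_n \pi(n)}^{ \epsilon_n } }{ \displaystyle \prod_{ j=0 }^n \left( 1 - z_0 \, z_{ \epsilon_{j+1} \pi(j+1) }^{ \epsilon_{j+1} } z_{ \epsilon_{j+2} \pi(j+2) }^{ \epsilon_{j+2} } \cdots z_{\epsilon_n \pi(n)}^{ \epsilon_n } \right) } \, , \] where for $j=n$ the product $z_{ \epsilon_{j+1} \pi(j+1) }^{ \epsilon_{j+1} }\cdots z_{\epsilon_n \pi(n)}^{ \epsilon_n }$ is empty (so that factor of the denominator is $1-z_0$).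
   Context: There are variables $z_0$, $s$, and $z_{j}, z_{-j}$ for $j\in[n]$; for $\epsilon_i=\pm1$ and $\pi(i)\in[n]$, $z_{\epsilon_i\pi(i)}^{\epsilon_i}$ means $z_{\pi(i)}$ if $\epsilon_i=1$ and $z_{-\pi(i)}^{-1}$ if $\epsilon_i=-1$. $[m]_z=1+z+\cdots+z^{m-1}$ (so $[0]_z=0$). $B_n$ is the set of signed permutations $(\pi,\epsilon)$ with $\pi\in S_n$, $\epsilon\in\{\pm1\}^n$; $\mathrm{neg}(\epsilon)$ is the number of $j$ with $\epsilon_j=-1$. Using the natural order $-n<\cdots<-1<1<\cdots<n$ and the convention $\epsilon_0\pi(0)=0$, the naturally ordered descent set is $\mathrm{NatDes}(\pi,\epsilon)=\{j\in\{0,1,\ldots,n-1\}:\epsilon_j\pi(j)>\epsilon_{j+1}\pi(j+1)\}$. *)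

(* Defs.v *)
From HB Require Import structures.
From mathcomp Require Import all_boot all_order all_fingroup all_algebra.
From mathcomp Require Import fraction.
From mathcomp Require Import boolp.
From mathcomp Require Import mpoly.

Set Implicit Arguments.
Unset Strict Implicit.
Unset Printing Implicit Defensive.

Import Order.TTheory GRing.Theory Num.Theory.

Local Open Scope ring_scope.

(* [laurent R m] is the ring R[x_0^{+-1}, ..., x_{m-1}^{+-1}], realized inside
   the fraction field of R[x_0, ..., x_{m-1}] as the subring of the fractions
   whose denominator is a monomial. *)
Section Laurent.
Variables (R : idomainType) (m : nat).

Definition is_laurent (x : {fraction {mpoly R[m]}}) : bool :=
  `[< exists (p : {mpoly R[m]}) (e : 'X_{1..m}),
        x = tofrac p / tofrac 'X_[R, e] >].

Lemma mpolyXf_neq0 (e : 'X_{1..m}) : tofrac ('X_[R, e] : {mpoly R[m]}) != 0.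
Proof.
rewrite tofrac_eq0; apply/eqP => /(congr1 (mcoeff e)) /eqP.
by rewrite mcoeffX mcoeff0 eqxx oner_eq0.
Qed.

Lemma is_laurent_subring : subring_closed is_laurent.
Proof.
split.
- apply/asboolP; exists 1, 0%MM.
  by rewrite mpolyX0 divr1.
- move=> x y /asboolP[p [a ->]] /asboolP[q [b ->]]; apply/asboolP.
  exists (p * 'X_[b] - q * 'X_[a]), (a + b)%MM.
  rewrite mpolyXD tofracB !tofracM -mulNr addf_div ?mpolyXf_neq0 //.
  by rewrite mulNr.
- move=> x y /asboolP[p [a ->]] /asboolP[q [b ->]]; apply/asboolP.
  exists (p * q), (a + b)%MM.
  by rewrite mpolyXD !tofracM mulf_div.
Qed.

HB.instance Definition _ :=
  GRing.isSubringClosed.Build {fraction {mpoly R[m]}} is_laurent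
    is_laurent_subring.

Record laurent : predArgType :=
  Laurent { laurent_val :> {fraction {mpoly R[m]}}; _ : is_laurent laurent_val }.

HB.instance Definition _ := [isSub for laurent_val].
HB.instance Definition _ := [Choice of laurent by <:].
HB.instance Definition _ := [SubChoice_isSubComNzRing of laurent by <:].

Definition laurent_unit (x : laurent) : bool :=
  (laurent_val x != 0) && is_laurent (laurent_val x)^-1.

Definition laurent_inv (x : laurent) : laurent :=
  if laurent_unit x then insubd x (laurent_val x)^-1 else x.

Lemma laurent_mulVx : {in laurent_unit, left_inverse 1 laurent_inv *%R}.
Proof.
move=> x ux; apply: val_inj; rewrite /= /laurent_inv.
have ux' : laurent_unit x by [].
rewrite ux'; case/andP: ux' => x0 xV.
by rewrite -[laurent_val (insubd _ _)]/(val _) val_insubd /= xV mulVf.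
Qed.

Lemma laurent_unitPl (x y : laurent) : y * x = 1 -> laurent_unit x.
Proof.
move=> /(congr1 val) /= yx1.
have x0 : laurent_val x != 0.
  by apply/eqP => x0; move/eqP: yx1; rewrite x0 mulr0 eq_sym oner_eq0.
rewrite /laurent_unit x0 /=.
suff -> : (laurent_val x)^-1 = laurent_val y by case: (y).
by apply: (mulIf x0); rewrite mulVf.
Qed.

Lemma laurent_inv_out : {in [predC laurent_unit], laurent_inv =1 id}.
Proof.
move=> x ux; rewrite /laurent_inv; have : ~~ laurent_unit x by [].
by move/negPf ->.
Qed.

HB.instance Definition _ := GRing.ComNzRing_hasMulInverse.Build laurent
  laurent_mulVx laurent_unitPl laurent_inv_out.

Lemma laurentX_subproof (i : 'I_m) : is_laurent (tofrac ('X_i : {mpoly R[m]})).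
Proof. by apply/asboolP; exists 'X_i, 0%MM; rewrite mpolyX0 divr1. Qed.

Definition laurentX (i : 'I_m) : laurent := Laurent (laurentX_subproof i).

Lemma laurentX_unit (i : 'I_m) : laurentX i \is a GRing.unit.
Proof.
rewrite unfold_in /= /laurent_unit /= mpolyXf_neq0 /=.
by apply/asboolP; exists 1, U_(i)%MM; rewrite tofrac1 div1r.
Qed.

End Laurent.

Record fps (R : Type) := Fps { fpscoef : nat -> R }.

HB.instance Definition _ (R : Type) := gen_eqMixin (fps R).
HB.instance Definition _ (R : Type) := gen_choiceMixin (fps R).

Lemma fpsP (R : Type) (f g : fps R) : fpscoef f =1 fpscoef g -> f = g.
Proof. by case: f g => [f] [g] /= /funext ->. Qed.

Section FpsRing.
Variable R : comNzRingType.
Implicit Types f g h : fps R.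

Definition fps0 : fps R := Fps (fun=> 0).
Definition fps_opp f : fps R := Fps (fun k => - fpscoef f k).
Definition fps_add f g : fps R := Fps (fun k => fpscoef f k + fpscoef g k).

Lemma fps_addA : associative fps_add.
Proof. by move=> f g h; apply: fpsP => k /=; rewrite addrA. Qed.
Lemma fps_addC : commutative fps_add.
Proof. by move=> f g; apply: fpsP => k /=; rewrite addrC. Qed.
Lemma fps_add0 : left_id fps0 fps_add.
Proof. by move=> f; apply: fpsP => k /=; rewrite add0r. Qed.
Lemma fps_addN : left_inverse fps0 fps_opp fps_add.
Proof. by move=> f; apply: fpsP => k /=; rewrite addNr. Qed.

HB.instance Definition _ :=
  GRing.isZmodule.Build (fps R) fps_addA fps_addC fps_add0 fps_addN.

Definition fpsC (c : R) : fps R := Fps (fun k => if k is 0%N then c else 0).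
Definition fpsX : fps R := Fps (fun k => (k == 1%N)%:R).
Definition fps_mul f g : fps R :=
  Fps (fun k => \sum_(i < k.+1) fpscoef f i * fpscoef g (k - i)).

Definition fps_trunc (N : nat) f : {poly R} := \poly_(i < N) fpscoef f i.

Lemma coef_fps_mul N k f g : (k < N)%N ->
  fpscoef (fps_mul f g) k = (fps_trunc N f * fps_trunc N g)`_k.
Proof.
move=> kN; rewrite /= coefM; apply: eq_bigr => i _.
rewrite !coef_poly (leq_ltn_trans _ kN) ?(leq_ltn_trans (leq_subr _ _) kN) //.
by rewrite -ltnS.
Qed.

Lemma fps_mulC : commutative fps_mul.
Proof.
by move=> f g; apply: fpsP => k; rewrite !(coef_fps_mul _ _ (ltnSn k)) mulrC.
Qed.

Lemma fps_mulA : associative fps_mul.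
Proof.
move=> f g h; apply: fpsP => k.
have coefMM (u v w : fps R) :
    fpscoef (fps_mul u (fps_mul v w)) k =
    (fps_trunc k.+1 u * (fps_trunc k.+1 v * fps_trunc k.+1 w))`_k.
  rewrite coefM; apply: eq_bigr => i _.
  rewrite coef_poly ltn_ord; congr (_ * _).
  by rewrite (@coef_fps_mul k.+1) // ltnS leq_subr.
by rewrite [fps_mul (fps_mul _ _) _]fps_mulC !coefMM mulrA mulrC.
Qed.

Lemma fps_mul1 : left_id (fpsC 1) fps_mul.
Proof.
move=> f; apply: fpsP => k /=.
by rewrite big_ord_recl /= mul1r subn0 big1 ?addr0 // => i _; rewrite mul0r.
Qed.

Lemma fps_mulDl : left_distributive fps_mul fps_add.
Proof.
move=> f g h; apply: fpsP => k /=.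
by rewrite -big_split /=; apply: eq_bigr => i _; rewrite mulrDl.
Qed.

Lemma fps1_neq0 : fpsC 1 != 0.
Proof.
apply/eqP => /(congr1 (fun f => fpscoef f 0)) /= /eqP.
by rewrite oner_eq0.
Qed.

HB.instance Definition _ := GRing.Zmodule_isComNzRing.Build (fps R)
  fps_mulA fps_mulC fps_mul1 fps_mulDl fps1_neq0.

End FpsRing.

Arguments fpsX {R}.

Section FpsUnit.
Variable R : comUnitRingType.
Implicit Types f g : fps R.

Definition fps_unit f : bool := fpscoef f 0 \is a GRing.unit.

(* The first k coefficients b_0, ..., b_{k-1} of the inverse of
   f = sum_i a_i X^i, from a_0 b_k = [k = 0] - sum_(i < k) a_(k - i) b_i. *)
Fixpoint fps_invseq f (k : nat) : seq R :=
  if k is l.+1 then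
    let b := fps_invseq f l in
    rcons b ((fpscoef f 0)^-1 *
             ((l == 0%N)%:R - \sum_(i < l) fpscoef f (l - i) * b`_i))
  else [::].

Definition fps_inv f : fps R :=
  if fps_unit f then Fps (fun k => (fps_invseq f k.+1)`_k) else f.

Lemma size_fps_invseq f k : size (fps_invseq f k) = k.
Proof. by elim: k => //= k IHk; rewrite size_rcons IHk. Qed.

Lemma nth_fps_invseq f k i : (i < k)%N ->
  (fps_invseq f k)`_i = (fps_invseq f i.+1)`_i.
Proof.
elim: k => // k IHk; rewrite ltnS leq_eqVlt => /predU1P[-> //|ik].
by rewrite [LHS]/= nth_rcons size_fps_invseq ik IHk.
Qed.

Lemma fps_mulVx : {in fps_unit, left_inverse 1 fps_inv *%R}.
Proof.
move=> f uf; have {uf} uf : fps_unit f by [].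
apply: fpsP => k; rewrite [fps_inv f * f]mulrC /fps_inv uf.
rewrite [LHS]/= big_ord_recl subn0 [X in _ * X + _]/=.
rewrite nth_rcons size_fps_invseq ltnn eqxx mulrA divrr // mul1r.
rewrite [X in _ + X](reindex_inj rev_ord_inj) /=.
rewrite [X in _ - X + _](eq_bigr (fun i : 'I_k =>
  fpscoef f (k - i) * (fps_invseq f i.+1)`_i)) => [|i _]; last first.
  by rewrite nth_fps_invseq.
rewrite [X in _ + X](eq_bigr (fun i : 'I_k =>
  fpscoef f (k - i) * (fps_invseq f i.+1)`_i)) => [|i _]; last first.
  by rewrite /bump /= add1n -subSn // subSS subKn // ltnW.
by rewrite subrK; case: (k).
Qed.

Lemma fps_unitPl f g : g * f = 1 -> fps_unit f.
Proof.
move=> /(congr1 (fun h => fpscoef h 0)) /=.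
rewrite big_ord1 => gf1; apply/unitrPr; exists (fpscoef g 0).
by rewrite mulrC.
Qed.

Lemma fps_inv_out : {in [predC fps_unit], fps_inv =1 id}.
Proof.
move=> f uf; rewrite /fps_inv; have : ~~ fps_unit f by [].
by move/negPf ->.
Qed.

HB.instance Definition _ := GRing.ComNzRing_hasMulInverse.Build (fps R)
  fps_mulVx fps_unitPl fps_inv_out.

Lemma fps_geom_unit (c : R) : (1 - fpsX * fpsC c : fps R) \is a GRing.unit.
Proof.
rewrite unfold_in /= /fps_unit /= big_ord1 /= mul0r subr0.
exact: unitr1.
Qed.

End FpsUnit.

(* The elements 1, ..., n of [n] are represented by 0, ..., n - 1 : 'I_n, so
   that [i : 'I_n] stands for the position (or the value) i + 1.  In
   [(p, e) : signed_perm n], the sign of position i is -1 iff [e i] holds. *)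
Definition signed_perm (n : nat) : Type := ('S_n * {ffun 'I_n -> bool})%type.

HB.instance Definition _ n := Finite.on (signed_perm n).

Section SignedPerm.
Variables (n : nat) (w : signed_perm n).

Definition sp_neg : nat := #|[set i : 'I_n | w.2 i]|.

(* eps_j pi(j) for 1 <= j <= n, and 0 for j = 0 *)
Definition sp_val (j : nat) : int :=
  if j is i.+1 then
    if insub i is Some i' then (-1) ^+ (w.2 i' : bool) * (w.1 i').+1%:Z else 0
  else 0.

Definition NatDes : {set 'I_n} := [set j : 'I_n | sp_val j.+1 < sp_val j].

End SignedPerm.

(* [k]_x = 1 + x + ... + x^(k-1) *)
Definition qint (R : pzSemiRingType) (k : nat) (x : R) : R := \sum_(i < k) x ^+ i.

Section ZVariables.
Variables (R : idomainType) (n : nat).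

(* The 1 + (n + n) variables are s, then z_1, ..., z_n, then z_{-1}, ..., z_{-n}. *)
Definition coefring : Type := laurent R (1 + (n + n)).
HB.instance Definition _ := GRing.ComUnitRing.on coefring.

Definition svar : coefring := laurentX R (lshift (n + n) (ord0 : 'I_1)).
Definition zpos (j : 'I_n) : coefring := laurentX R (rshift 1 (lshift n j)).
Definition zneg (j : 'I_n) : coefring := laurentX R (rshift 1 (rshift n j)).

(* z_{eps_i pi(i)}^{eps_i} *)
Definition zsgn (w : signed_perm n) (i : 'I_n) : coefring :=
  if w.2 i then (zneg (w.1 i))^-1 else zpos (w.1 i).

(* z_{eps_{j+1} pi(j+1)}^{eps_{j+1}} ... z_{eps_n pi(n)}^{eps_n}; the position
   j + 1 is the index j of 'I_n. *)
Definition ztail (w : signed_perm n) (j : nat) : coefring :=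
  \prod_(i < n | (j <= i)%N) zsgn w i.

End ZVariables.

(* Main.v *)
Require Import Defs.
From HB Require Import structures.
From mathcomp Require Import all_boot all_order all_fingroup all_algebra.
From mathcomp Require Import zify.

(** Expanding the geometric series, the coefficient of [z_0^k] in the summand of
    a signed permutation [w] is a sum over the exponent vectors
    [0 <= a_1 <= ... <= a_n <= k] of its letters, with a strict increase at each
    descent of [w].  This chain condition says that the pairs (exponent, signed
    letter) increase lexicographically from [(0, 0)].  Hence every assignment of a
    sign and an exponent at most [k] to each of the letters [1, ..., n], with
    positive exponents on the negative letters, arises from exactly one signed
    permutation, the one which sorts these pairs; the generating function of the
    assignments is the product on the left-hand side. *)

Set Implicit Arguments.
Unset Strict Implicit.
Unset Printing Implicit Defensive.

Import GRing.Theory.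
Local Open Scope ring_scope.

(** * Coefficients of power series *)

Section FpsCoef.
Variable A : comNzRingType.

Lemma coef_fpsCM (c : A) (f : fps A) k : fpscoef (fpsC c * f) k = c * fpscoef f k.
Proof.
rewrite [LHS]/= big_ord_recl /= subn0 big1 ?addr0 // => i _.
by rewrite mul0r.
Qed.

Lemma coef_fpsXM (f : fps A) k :
  fpscoef (fpsX * f) k = if k is l.+1 then fpscoef f l else 0.
Proof.
rewrite [LHS]/= big_ord_recl /= mul0r add0r.
case: k => [|k]; first by rewrite big_ord0.
rewrite big_ord_recl /= mul1r subSS subn0 big1 ?addr0 // => i _.
by rewrite /bump /= mul0r.
Qed.

Lemma coef_fps_sum (I : finType) (P : pred I) (F : I -> fps A) k :
  fpscoef (\sum_(i | P i) F i) k = \sum_(i | P i) fpscoef (F i) k.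
Proof. exact: (big_morph (fun f => fpscoef f k)). Qed.

End FpsCoef.

(** * Generating functions of chains of exponents *)

Section ChainSum.
Variables (A : comNzRingType) (z : nat -> A) (d : nat -> bool).

(** The exponents increase weakly up to [k], and strictly into each position where [d] holds (from 0
    at position 0). The guard [d m <= i] keeps truncated subtraction from admitting [i = 0]
    there. *)
Fixpoint chain_sum (n k : nat) : A :=
  if n is m.+1 then
    \sum_(i < k.+1 | (d m <= i)%N) z m ^+ i * chain_sum m (i - d m)
  else 1.

(* The dilation parameter [u] makes the induction work: peeling off the last
   position replaces [u] by [u * z n]. *)
Lemma chain_sum_genfun n u :
  Fps (fun k => u ^+ k * chain_sum n k)
    * \prod_(j < n.+1) (1 - fpsX * fpsC (u * \prod_(j <= i < n) z i))
  = \prod_(j < n | d j) (fpsX * fpsC (u * \prod_(j <= i < n) z i)).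
Proof.
have geom g (c : A) : (1 - fpsX * fpsC c) * Fps g
    = Fps (fun k => g k - if k is l.+1 then c * g l else 0).
  rewrite mulrBl mul1r -mulrA; apply: fpsP => k.
  rewrite -[LHS]/(g k - fpscoef (fpsX * (fpsC c * Fps g)) k).
  by rewrite coef_fpsXM; case: k => // k; rewrite coef_fpsCM.
elim: n u => [|n IHn] u.
  rewrite big_ord1 big_ord0 big_geq // mulr1 mulrC geom.
  apply: fpsP => -[|k] /=; first by rewrite subr0 mulr1.
  by rewrite !mulr1 exprS subrr.
set F := Fps _.
rewrite big_ord_recr /= [X in _ - _ * fpsC (_ * X)]big_geq // mulr1.
rewrite mulrCA [X in _ * X]mulrC.
(* This factor subtracts from each coefficient [u] times the previous one, so only the term with
   last exponent equal to [k] survives. *)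
have -> : (1 - fpsX * fpsC u) * F
  = (if d n then fpsX * fpsC (u * z n) else 1)
    * Fps (fun k => (u * z n) ^+ k * chain_sum n k).
  rewrite geom; apply: fpsP => k.
  have -> : fpscoef ((if d n then fpsX * fpsC (u * z n) else 1) *
     Fps (fun k => (u * z n) ^+ k * chain_sum n k)) k
     = if (d n <= k)%N then (u * z n) ^+ k * chain_sum n (k - d n) else 0.
    case: (d n); last by rewrite mul1r subn0.
    rewrite -mulrA coef_fpsXM; case: k => // k.
    by rewrite coef_fpsCM /= subSS subn0 mulrA -exprS.
  case: k => [|k].
    rewrite /= subr0 expr0 mul1r big_mkcond big_ord1 /=.
    by rewrite !expr0.
  rewrite [LHS]/= [\sum_(i < k.+2 | _) _]big_mkcond big_ord_recr /=.
  rewrite -[in X in X + _]big_mkcond mulrDr mulrA -exprS addrC addKr.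
  by case: ifP => _; rewrite ?mulr0 // exprMn mulrA.
have tailE j : (j <= n)%N ->
    u * \prod_(j <= i < n.+1) z i = u * z n * \prod_(j <= i < n) z i.
  by move=> jn; rewrite big_nat_recr //= [X in u * X]mulrC mulrA.
rewrite [RHS]big_mkcond [RHS]big_ord_recr /= -big_mkcond mulrCA mulrC; congr (_ * _).
  rewrite (eq_bigr (fun j : 'I_n.+1 =>
    1 - fpsX * fpsC (u * z n * \prod_(j <= i < n) z i))) => [|j _]; last first.
    by rewrite tailE // -ltnS.
  rewrite mulrC IHn; apply: eq_bigr => j _.
  by rewrite tailE // ltnW.
by rewrite tailE // big_geq // mulr1.
Qed.

End ChainSum.

(** * Chains as explicit exponent vectors *)

Definition ord_ext (T : Type) (x0 : T) (n : nat) (g : 'I_n -> T) (i : nat) : T :=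
  oapp g x0 (insub i).

Lemma ord_extE T (x0 : T) n (g : 'I_n -> T) (i : 'I_n) : ord_ext x0 g i = g i.
Proof. by rewrite /ord_ext valK. Qed.

(** The recursion of [chain_sum], as a condition on a single exponent vector. *)
Fixpoint chain (d : nat -> bool) (a : nat -> nat) (n k : nat) : bool :=
  if n is m.+1 then [&& (d m <= a m)%N, (a m <= k)%N & chain d a m (a m - d m)]
  else true.

Lemma eq_chain d a b n k :
  (forall i, (i < n)%N -> a i = b i) -> chain d a n k = chain d b n k.
Proof.
elim: n k => //= n IHn k ab; rewrite ab // IHn // => i ltin.
by apply: ab; rewrite ltnW.
Qed.

(** Induction on the last exponent; the box size [K] stays fixed while the bound [k] shrinks along
    the recursion. *)
Lemma chain_sumE (A : comNzRingType) (z : nat -> A) d n K k : (k < K)%N ->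
  chain_sum z d n k
  = \sum_(a : {ffun 'I_n -> 'I_K} | chain d (ord_ext 0%N (@nat_of_ord K \o a)) n k)
      \prod_(i < n) z i ^+ a i.
Proof.
elim: n k => [|n IHn] k ltkK /=.
  rewrite (eq_bigr (fun=> 1)) => [|a _]; last by rewrite big_ord0.
  by rewrite sumr_const card_ffun !card_ord expn0.
(* [rc] appends [p.1] to the vector [p.2] as its last entry. *)
pose rc (p : 'I_K * {ffun 'I_n -> 'I_K}) : {ffun 'I_n.+1 -> 'I_K} :=
  [ffun i => oapp p.2 p.1 (unlift ord_max i)].
have rc_max p : rc p ord_max = p.1 by rewrite ffunE unlift_none.
have rc_lift p j : rc p (widen_ord (leqnSn n) j) = p.2 j.
  have -> : widen_ord (leqnSn n) j = lift ord_max j.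
    by apply: val_inj; rewrite /= /bump leqNgt ltn_ord.
  by rewrite ffunE liftK.
have rc_bij : bijective rc.
  exists (fun a : {ffun 'I_n.+1 -> 'I_K} =>
    (a ord_max, [ffun j => a (widen_ord (leqnSn n) j)])).
  - move=> [b a] /=; rewrite rc_max; congr pair; apply/ffunP => j.
    by rewrite ffunE rc_lift.
  - move=> a; apply/ffunP => i; have [j ->|->] := unliftP ord_max i.
      have -> : lift ord_max j = widen_ord (leqnSn n) j.
        by apply: val_inj; rewrite /= /bump leqNgt ltn_ord.
      by rewrite rc_lift ffunE.
    by rewrite rc_max.
have chain_rc p : chain d (ord_ext 0%N (@nat_of_ord K \o (rc p))) n.+1 k
    = ((d n <= p.1)%N && (p.1 <= k)%N) && chain d (ord_ext 0%N (@nat_of_ord K \o p.2)) n (p.1 - d n).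
  have extn : ord_ext 0%N (@nat_of_ord K \o (rc p)) n = p.1.
    by rewrite -[n in LHS]/(val (@ord_max n)) ord_extE /= rc_max.
  rewrite /= extn -andbA; congr [&& _, _ & _]; apply: eq_chain => i ltin.
  rewrite -[i in LHS]/(val (widen_ord (leqnSn n) (Ordinal ltin))) ord_extE.
  by rewrite /= rc_lift -[i in RHS]/(val (Ordinal ltin)) ord_extE.
rewrite (reindex rc) /=; last exact: onW_bij.
rewrite (eq_bigl _ _ chain_rc).
rewrite -(pair_big_dep (fun b : 'I_K => (d n <= b)%N && (b <= k)%N)
  (fun (b : 'I_K) (a : {ffun 'I_n -> 'I_K}) => chain d (ord_ext 0%N (@nat_of_ord K \o a)) n (b - d n))
  (fun b a => \prod_(i < n.+1) z i ^+ rc (b, a) i)) /=.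
rewrite (big_ord_widen_cond K (fun i => d n <= i)%N
  (fun i => z n ^+ i * chain_sum z d n (i - d n))) //.
apply: eq_bigr => b /andP[_ lebk].
rewrite IHn ?(leq_ltn_trans (leq_subr _ _)) // mulr_sumr.
apply: eq_bigr => a _; rewrite big_ord_recr /= rc_max mulrC; congr (_ * _).
by apply: eq_bigr => i _; rewrite rc_lift.
Qed.

(** * Increasing integer keys and sorting *)

Definition seq_from0 (T : Type) (x0 : T) (g : nat -> T) (j : nat) : T :=
  if j is i.+1 then g i else x0.

(* A lexicographic comparison (first [a], then [v]) becomes a comparison of
   single integers [a * M + v] as soon as [M] exceeds the spread of [v]. *)
Lemma chain_keyP (M : int) (v : nat -> int) (a : nat -> nat) n k :
  (forall i j, (i <= n)%N -> (j <= n)%N -> v i - v j < M) ->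
  (forall j, (j < n)%N -> v j != v j.+1) ->
  let A := seq_from0 0%N a in
  chain (fun j => v j.+1 < v j) a n k
  <-> (A n <= k)%N /\
      (forall j, (j < n)%N -> (A j)%:Z * M + v j < (A j.+1)%:Z * M + v j.+1).
Proof.
move=> + + A; elim: n k => [|n IHn] k vM vneq //=.
have {IHn} IHn l := IHn l (fun i j hi hj => vM i j (leqW hi) (leqW hj))
                        (fun j hj => vneq j (leqW hj)).
have M_gt0 : 0 < M by have := vM 0%N 0%N isT isT; rewrite subrr.
(* Unequal exponents decide the comparison because the [v] differ by less than [M]; on equal
   exponents [vneq] makes a non-descent a strict increase. *)
have stepP : (A n + (v n.+1 < v n)%R <= a n)%N
             <-> (A n)%:Z * M + v n < (a n)%:Z * M + v n.+1.
  have := vneq n (ltnSn n); have := vM n n.+1 (leqnSn n) (leqnn _).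
  have := vM n.+1 n (leqnn _) (leqnSn n).
  move: (A n) (a n) (v n) (v n.+1) => x y p q.
  case: (ltngtP x y) => [xy|yx|->].
  - have: 0 <= (y%:Z - x%:Z - 1) * M by rewrite Num.Theory.mulr_ge0 //; lia.
    by lia.
  - have: 0 <= (x%:Z - y%:Z - 1) * M by rewrite Num.Theory.mulr_ge0 //; lia.
    by lia.
  - by lia.
split.
- case/and3P=> dle alek /IHn[Ale keys]; split=> // j.
  rewrite ltnS leq_eqVlt => /predU1P[->|]; last exact: keys.
  by apply/stepP; move: dle Ale; lia.
- case=> alek keys; have /stepP := keys n (ltnSn n) => An.
  have dle : ((v n.+1 < v n)%R <= a n)%N by rewrite (leq_trans _ An) ?leq_addl.
  rewrite dle alek /=; apply/IHn; split; first by move: An; lia.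
  by move=> j ltjn; apply: keys; rewrite ltnW.
Qed.

Lemma seq_from0_increasingP n (K : 'I_n -> int) :
  (forall j, (j < n)%N -> seq_from0 0 (ord_ext 0 K) j < seq_from0 0 (ord_ext 0 K) j.+1)
  <-> (forall i, 0 < K i) /\ {homo K : i j / (i < j)%N >-> i < j}.
Proof.
set g := seq_from0 _ _.
have gE (i : 'I_n) : g i.+1 = K i by rewrite /g /= ord_extE.
split=> [incr | [Kgt0 Kincr] [|j] ltjn].
- have mono i j : (i < j)%N -> (j <= n)%N -> g i < g j.
    elim: j => // j IHj; rewrite ltnS leq_eqVlt => /predU1P[->|ltij] lejn.
      exact: incr.
    by apply: (Order.POrderTheory.lt_trans (IHj ltij (ltnW lejn))); apply: incr.
  split=> [i|i j ltij]; first by rewrite -gE -[0]/(g 0%N) mono.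
  by rewrite -!gE mono.
- by rewrite -[1%N]/(val (Ordinal ltjn)).+1 gE.
- have ltjn' := ltnW ltjn.
  rewrite -[j.+1]/(val (Ordinal ltjn')).+1 gE.
  by rewrite -[(_ : nat).+1]/(val (Ordinal ltjn)).+1 gE Kincr.
Qed.

(** The inverse of the sorting permutation is the rank map, sending [v] to the number of keys below
    [K v]. *)
Lemma sorting_perm n (K : 'I_n -> int) : injective K ->
  exists p0 : 'S_n, forall p : 'S_n,
    {homo K \o p : i j / (i < j)%N >-> i < j} <-> p = p0.
Proof.
move=> Kinj.
pose rk v := #|[set u | K u < K v]|.
have rk_mono u v : K u < K v -> (rk u < rk v)%N.
  move=> uv; apply: proper_card; apply/properP; split.
    by apply/subsetP => w; rewrite !inE => /Order.POrderTheory.lt_trans; apply.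
  by exists u; rewrite inE // Order.POrderTheory.ltxx.
have rk_lt v : (rk v < n)%N.
  rewrite -[X in (_ < X)%N](card_ord n) -cardsT; apply: proper_card.
  rewrite properT; apply/eqP => /setP/(_ v).
  by rewrite !inE Order.POrderTheory.ltxx.
pose r v := Ordinal (rk_lt v).
have r_inj : injective r.
  move=> u v /(congr1 val) /= ruv; apply: Kinj.
  by case: (Order.TotalTheory.ltgtP (K u) (K v)) => // /rk_mono; rewrite ruv ltnn.
exists (perm r_inj)^-1%g => p; split=> [pK|->].
- rewrite -[p]invgK; congr (_^-1)%g.
  apply/permP => v; rewrite [RHS]permE; apply: val_inj; rewrite [RHS]/=.
  rewrite -[v in RHS](permKV p) /rk; set i := p^-1%g v.
  rewrite -(card_imset _ (@perm_inj _ p^-1%g)).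
  (* In an increasing arrangement the keys below [K (p i)] sit exactly at the positions before [i],
     so the rank of [p i] is [i]. *)
  have -> : [set p^-1%g x | x in [set u | K u < K (p i)]] = [set j : 'I_n | (j < i)%N].
    apply/setP => j; rewrite inE; apply/imsetP/idP => [[u]|ltji].
      rewrite inE => Ku ->; rewrite ltnNge leq_eqVlt; apply/negP => /orP[/eqP/val_inj|].
        by move=> ij; move: Ku; rewrite ij permKV Order.POrderTheory.ltxx.
      move/pK => /=; rewrite permKV => /(Order.POrderTheory.lt_trans Ku).
      by rewrite Order.POrderTheory.ltxx.
    by exists (p j); rewrite ?permK // inE; apply: pK.
  rewrite cardsE -sum1_card (big_ord_narrow (ltnW (ltn_ord i))).
  by rewrite sum1_card card_ord.
- move=> i j ltij /=; rewrite Order.TotalTheory.ltNge; apply/negP => le_ji.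
  have rkp (l : 'I_n) : rk ((perm r_inj)^-1%g l) = l.
    by rewrite -[rk _]/(val (r _)) -(permE r_inj) permKV.
  move: le_ji; rewrite Order.POrderTheory.le_eqVlt => /orP[/eqP/Kinj/perm_inj|/rk_mono].
    by move=> ji; move: ltij; rewrite ji ltnn.
  by rewrite !rkp ltnNge ltnW.
Qed.

(** The case [u = 1] of [chain_sum_genfun], divided by the invertible denominator. *)
Lemma coef_chain_frac (A : comUnitRingType) (z : nat -> A) (d : nat -> bool) n k :
  fpscoef ((\prod_(j < n | d j) (fpsX * fpsC (\prod_(j <= i < n) z i)))
           / (\prod_(j < n.+1) (1 - fpsX * fpsC (\prod_(j <= i < n) z i)))) k
  = chain_sum z d n k.
Proof.
have := chain_sum_genfun z d n 1.
under eq_bigr do rewrite mul1r.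
under [in RHS]eq_bigr do rewrite mul1r.
move=> <-; rewrite mulrK; first by rewrite /= expr1n mul1r.
by apply: rpred_prod => j _; exact: fps_geom_unit.
Qed.

(** * Keys of signed letters and values of signed permutations *)

Section SignedKey.
Variables (n : nat) (f : 'I_n -> bool) (b : 'I_n -> nat).

(** Encodes the pair (exponent, signed letter); the modulus [2n + 1] exceeds every difference of two
    numbers in [[-n, n]]. *)
Definition signed_key (v : 'I_n) : int :=
  (b v)%:Z * (n.*2.+1)%:Z + (-1) ^+ f v * v.+1%:Z.

(** A positive exponent outweighs the letter, and a zero exponent leaves the sign to it; so
    positivity fails only for a negative letter with exponent 0. *)
Lemma signed_key_gt0 v : (0 < signed_key v) = (f v <= b v)%N.
Proof.
rewrite /signed_key; have := ltn_ord v; move: (b v) (nat_of_ord v) => c m ltmn.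
case: (f v) => /=; rewrite ?expr0 ?expr1 ?mul1r ?mulN1r; last by nia.
by case: c => [|c]; nia.
Qed.

Lemma signed_key_inj : injective signed_key.
Proof.
move=> u v; rewrite /signed_key => Kuv; apply: val_inj => /=; move: Kuv.
have := ltn_ord u; have := ltn_ord v.
move: (b u) (b v) (nat_of_ord u) (nat_of_ord v) => c1 c2 m1 m2 lt2 lt1.
have [c12|c21|->] := ltngtP c1 c2.
- have /subnKC <- := c12; move: (c2 - c1.+1)%N => t.
  by case: (f u); case: (f v) => /=; rewrite ?expr0 ?expr1 ?mul1r ?mulN1r; nia.
- have /subnKC <- := c21; move: (c1 - c2.+1)%N => t.
  by case: (f u); case: (f v) => /=; rewrite ?expr0 ?expr1 ?mul1r ?mulN1r; nia.
- by case: (f u); case: (f v) => /=; rewrite ?expr0 ?expr1 ?mul1r ?mulN1r; nia.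
Qed.

End SignedKey.

Section SpVal.
Variables (n : nat) (w : signed_perm n).

Lemma sp_valS (i : 'I_n) : sp_val w i.+1 = (-1) ^+ w.2 i * (w.1 i).+1%:Z.
Proof. by rewrite /sp_val valK. Qed.

Lemma sp_val_bound j : - n%:Z <= sp_val w j <= n%:Z.
Proof.
case: j => [|j]; first by rewrite /=; lia.
rewrite /sp_val; case: insubP => [i _ _|_]; last by lia.
have := ltn_ord (w.1 i); case: (w.2 i); rewrite /= ?expr0 ?expr1; lia.
Qed.

(** Letters at distinct positions differ in absolute value, and none is 0. This supplies the
    hypothesis on [v] in [chain_keyP]. *)
Lemma sp_val_step_neq j : (j < n)%N -> sp_val w j != sp_val w j.+1.
Proof.
move=> ltjn; rewrite (sp_valS (Ordinal ltjn)).
case: j ltjn => [|j] ltjn.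
  by case: (w.2 _); rewrite /= ?expr0 ?expr1; lia.
have ltjn' := ltnW ltjn; rewrite (sp_valS (Ordinal ltjn')).
have : w.1 (Ordinal ltjn) != w.1 (Ordinal ltjn').
  by rewrite (inj_eq perm_inj) -val_eqE /=; lia.
rewrite -val_eqE /=.
by case: (w.2 _); case: (w.2 _); rewrite /= ?expr0 ?expr1; lia.
Qed.

End SpVal.

(** * Assignments to letters versus signed permutations with chains *)

Lemma chain_sortP n (f : 'I_n -> bool) (b : 'I_n -> nat) (p : 'S_n) k :
  (forall v, (b v <= k)%N) ->
  let w : signed_perm n := (p, [ffun i => f (p i)]) in
  chain (fun j => sp_val w j.+1 < sp_val w j) (ord_ext 0%N (b \o p)) n k
  <-> (forall v, (f v <= b v)%N) /\
      {homo signed_key f b \o p : i j / (i < j)%N >-> i < j}.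
Proof.
move=> lebk w; set K := signed_key f b \o p.
(* The integers compared by [chain_keyP] are 0, followed by the signed keys of the letters in the
   order of [p]. *)
have keyE j : (j <= n)%N -> (seq_from0 0%N (ord_ext 0%N (b \o p)) j)%:Z * (n.*2.+1)%:Z
    + sp_val w j = seq_from0 0 (ord_ext 0 K) j.
  case: j => // j ltjn; rewrite (sp_valS w (Ordinal ltjn)).
  rewrite -[j.+1]/(val (Ordinal ltjn)).+1 /seq_from0 !ord_extE.
  by rewrite /= ffunE.
have -> : (forall v, (f v <= b v)%N) <-> (forall i, 0 < K i).
  split=> [fb i|Kp v]; first by rewrite signed_key_gt0.
  by rewrite -signed_key_gt0 -(permKV p v) (Kp _).
rewrite -seq_from0_increasingP.
rewrite (chain_keyP (M := (n.*2.+1)%:Z)) => [|i j _ _|j]; last first.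
- exact: sp_val_step_neq.
- by have := sp_val_bound w i; have := sp_val_bound w j; lia.
split=> [[_ keys] j ltjn|keys].
  by have := keys j ltjn; rewrite !keyE // ltnW.
split=> [|j ltjn]; last by rewrite !keyE ?keys // ltnW.
have ext_le m : (seq_from0 0 (ord_ext 0 (b \o p)) m <= k)%N; last exact: ext_le.
by case: m => //= m; rewrite /ord_ext; case: insub => //= i; apply: lebk.
Qed.

(** Expanding the product chooses a sign and an exponent for every letter; among all orders of the
    letters, only the sorting one makes the exponents a chain. *)
Lemma prod_sum_signed_perm (A : comNzRingType) n k (F : 'I_n -> bool * 'I_k.+1 -> A) :
  \prod_v \sum_(x : bool * 'I_k.+1 | (x.1 <= x.2)%N) F v x
  = \sum_(w : signed_perm n)
      \sum_(a : {ffun 'I_n -> 'I_k.+1} |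
              chain (fun j => sp_val w j.+1 < sp_val w j)
                    (ord_ext 0%N (@nat_of_ord k.+1 \o a)) n k)
        \prod_i F (w.1 i) (w.2 i, a i).
Proof.
(* [wa] turns signs and exponents indexed by letters into ones indexed by positions. *)
pose wa (x : 'S_n * {ffun 'I_n -> bool * 'I_k.+1})
    : signed_perm n * {ffun 'I_n -> 'I_k.+1} :=
  ((x.1, [ffun i => (x.2 (x.1 i)).1]), [ffun i => (x.2 (x.1 i)).2]).
have wa_bij : bijective wa.
  exists (fun y : signed_perm n * {ffun 'I_n -> 'I_k.+1} =>
    let q : 'S_n := y.1.1^-1%g in (y.1.1, [ffun v => (y.1.2 (q v), y.2 (q v))])).
  - move=> [p g]; congr pair; apply/ffunP => v.
    by rewrite !ffunE /= permKV; case: (g v).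
  - move=> [[p e] a]; rewrite /wa /=; congr ((_, _), _); apply/ffunP => i;
      by rewrite !ffunE /= permK.
have chain_waP (p : 'S_n) (g : {ffun 'I_n -> bool * 'I_k.+1}) :
  reflect ((forall v, ((g v).1 <= (g v).2)%N) /\
           {homo signed_key (fun v => (g v).1) (fun v => (g v).2) \o p
             : i j / (i < j)%N >-> i < j})
   (chain (fun j => sp_val (wa (p, g)).1 j.+1 < sp_val (wa (p, g)).1 j)
          (ord_ext 0%N (@nat_of_ord k.+1 \o (wa (p, g)).2)) n k).
  have sortP := @chain_sortP n (fun v => (g v).1) (fun v => (g v).2) p k
    (fun v => ltn_ord (g v).2).
  apply: (equivP idP); apply: iff_trans sortP.
  rewrite (@eq_chain _ _ (ord_ext 0%N ((fun v => nat_of_ord (g v).2) \o p))) // => i ltin.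
  by rewrite -[i]/(val (Ordinal ltin)) !ord_extE /= ffunE.
rewrite bigA_distr_big pair_big_dep /= (reindex wa) /=; last exact: onW_bij.
rewrite -(pair_big_dep xpredT (fun (p : 'S_n) (g : {ffun 'I_n -> bool * 'I_k.+1}) =>
   chain (fun j => sp_val (wa (p, g)).1 j.+1 < sp_val (wa (p, g)).1 j)
          (ord_ext 0%N (@nat_of_ord k.+1 \o (wa (p, g)).2)) n k)
   (fun p g => \prod_i F (p i) ((wa (p, g)).1.2 i, (wa (p, g)).2 i))) /=.
(* A chain forces the assignment [g] to be admissible, so the sum over [g] can be moved outside; the
   inner sum over [p] then has one term. *)
rewrite (exchange_big_dep (mem (ffun_on (fun x : bool * 'I_k.+1 => x.1 <= x.2)%N))) /=;
  last by move=> p g _ /chain_waP[fb _]; apply/ffun_onP => v; apply: fb.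
apply: eq_bigr => g /ffun_onP gQ.
have [p0 p0P] := sorting_perm (@signed_key_inj _ (fun v => (g v).1) (fun v => (g v).2)).
rewrite (big_pred1 p0) => [|p]; last first.
  apply/chain_waP/eqP => [[_ /p0P]//|/p0P pK].
  by split=> // v; apply: gQ.
rewrite (reindex_inj (@perm_inj _ p0)); apply: eq_bigr => i _.
by rewrite !ffunE /=; case: (g _).
Qed.

(** * The identity, coefficient by coefficient *)

Theorem theorem6p9 (R : idomainType) (n : nat) (n_gt0 : (0 < n)%N) :
  Fps (fun k : nat =>
    \prod_(j < n) (qint k.+1 (zpos R j)
                   + svar R n * (zneg R j)^-1 * qint k (zneg R j)^-1))
  = \sum_(w : signed_perm n)
      fpsC (svar R n ^+ sp_neg w)
      * ((\prod_(j in NatDes w) (fpsX * fpsC (ztail R w j)))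
         / (\prod_(j < n.+1) (1 - fpsX * fpsC (ztail R w j)))).
Proof.
apply: fpsP => k; rewrite coef_fps_sum [LHS]/=.
(* The weight of giving letter [v] the sign [x.1] and the exponent [x.2]. *)
pose F (v : 'I_n) (x : bool * 'I_k.+1) : coefring R n :=
  svar R n ^+ x.1 * (if x.1 then (zneg R v)^-1 else zpos R v) ^+ x.2.
transitivity (\prod_v \sum_(x : bool * 'I_k.+1 | (x.1 <= x.2)%N) F v x).
  apply: eq_bigr => v _.
  rewrite -(pair_big_dep xpredT (fun (e : bool) (c : 'I_k.+1) => e <= c)%N
              (fun e c => F v (e, c))) /=.
  rewrite big_bool /= addrC; congr (_ + _); rewrite /F /=.
    by apply: eq_bigr => c _; rewrite expr0 mul1r.
  (* A negative letter has exponent at least 1: the term of exponent 0 drops out, and shifting the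
     index pulls out one factor [(zneg R v)^-1]. *)
  rewrite [RHS]big_mkcond big_ord_recl /= add0r /qint mulr_sumr.
  by apply: eq_bigr => c _; rewrite expr1 exprS mulrA.
rewrite prod_sum_signed_perm; apply: eq_bigr => w _.
pose z := ord_ext 1 (zsgn R w).
have ztailE j : ztail R w j = \prod_(j <= i < n) z i.
  by rewrite big_geq_mkord; apply: eq_bigr => i _; rewrite /z ord_extE.
rewrite coef_fpsCM.
under eq_bigr do rewrite ztailE.
under [in X in _ / X]eq_bigr do rewrite ztailE.
rewrite (eq_bigl (fun j : 'I_n => sp_val w j.+1 < sp_val w j)); last first.
  by move=> j; rewrite inE.
rewrite (coef_chain_frac z (fun j => sp_val w j.+1 < sp_val w j)).
rewrite (chain_sumE z _ n (ltnSn k)) mulr_sumr; apply: eq_bigr => a _.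
rewrite /F big_split /=; congr (_ * _).
  rewrite /sp_neg -sum1dep_card -prodrXr (bigID (fun i => w.2 i)) /=.
  rewrite [X in _ * X]big1 => [|i /negPf -> //]; rewrite mulr1.
  by apply: eq_bigr => i ->.
by apply: eq_bigr => i _; rewrite /z ord_extE.
Qed.
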